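(* Let $Q$ be a bisimple inverse $\omega$-semigroup and let $S$ be a left I-order in $Q$. Then $S$ is straight in $Q$; that is, every element of $Q$ can be written as $a^{-1}b$ with $a,b\in S$ and $a\,\mathcal{R}\,b$ in $Q$.
   Context: A subsemigroup $S$ of an inverse semigroup $Q$ is a left I-order in $Q$ if every element of $Q$ can be written as $a^{-1}b$ with $a,b\in S$, where $a^{-1}$ is the inverse of $a$ in $Q$ in the sense of inverse semigroup theory. A bisimple inverse $\omega$-semigroup is an inverse semigroup with a single $\mathcal{D}$-class whose idempotents form an $\omega$-chain $e_0\geqslant e_1\geqslant e_2\geqslant\cdots$ indexed by the non-negative integers, with $e_m\leqslant e_n$ if and only if $m\geqslant n$ (equivalently, by Reilly's theorem, it is isomorphic to some $S(G,\theta)=\mathbb{N}^0\times G\times\mathbb{N}^0$, $G$ a group and $\theta$ an endomorphism of $G$, with multiplication $(m,g,n)(p,h,q)=(m-n+t,(g\theta^{t-n})(h\theta^{t-p}),q-p+t)$, $t=\max\{n,p\}$, $\theta^0$ being the identity map). *)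

(* Defs.v *)
From HB Require Import structures.
From mathcomp Require Import all_boot.

Set Implicit Arguments.
Unset Strict Implicit.
Unset Printing Implicit Defensive.

Local Open Scope group_scope.

Definition mutually_inverse (Q : semigroupType) (x y : Q) : Prop :=
  x * y * x = x /\ y * x * y = y.

(* The library's [x^-1] needs a unit element, which an inverse semigroup may
   lack, so the inversion is a new operation. *)
HB.mixin Record Semigroup_isInverse Q of Semigroup Q := {
  isg_inv : Q -> Q;
  isg_invP : forall x : Q, mutually_inverse x (isg_inv x);
  isg_inv_uniq : forall x y : Q, mutually_inverse x y -> y = isg_inv x
}.

#[short(type="inverseSemigroupType")]
HB.structure Definition InverseSemigroup :=
  {Q of Semigroup_isInverse Q & Semigroup Q}.

Declare Scope isg_scope.
Delimit Scope isg_scope with isg.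
Notation "x ^-1" := (isg_inv x) : isg_scope.

Section Green.
Variable Q : semigroupType.
Implicit Types a b c : Q.

(* [a] lies in [b Q^1] (resp. [Q^1 b]), [Q^1] being [Q] with an identity
   adjoined if necessary. *)
Definition in_right_ideal a b : Prop := a = b \/ exists x : Q, a = b * x.
Definition in_left_ideal a b : Prop := a = b \/ exists x : Q, a = x * b.

Definition greenR a b : Prop := in_right_ideal a b /\ in_right_ideal b a.
Definition greenL a b : Prop := in_left_ideal a b /\ in_left_ideal b a.
Definition greenD a b : Prop := exists c, greenL a c /\ greenR c b.

Definition idempotent_elt a : Prop := a * a = a.

(* The natural partial order, on idempotents. *)
Definition idempotent_le a b : Prop := a * b = a /\ b * a = a.

End Green.

Definition bisimple (Q : semigroupType) : Prop := forall a b : Q, greenD a b.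

Definition idempotents_omega_chain (Q : semigroupType) : Prop :=
  exists e : nat -> Q,
    (forall x : Q, idempotent_elt x <-> exists n, x = e n) /\
    (forall m n : nat, idempotent_le (e m) (e n) <-> (n <= m)%N).

Definition bisimple_inverse_omega (Q : inverseSemigroupType) : Prop :=
  bisimple Q /\ idempotents_omega_chain Q.

Definition subsemigroup (Q : semigroupType) (S : Q -> Prop) : Prop :=
  forall a b : Q, S a -> S b -> S (a * b).

Definition left_I_order (Q : inverseSemigroupType) (S : Q -> Prop) : Prop :=
  subsemigroup S /\
  forall q : Q, exists a b : Q, [/\ S a, S b & q = a^-1%isg * b].

Definition straight (Q : inverseSemigroupType) (S : Q -> Prop) : Prop :=
  forall q : Q, exists a b : Q, [/\ S a, S b, greenR a b & q = a^-1%isg * b].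

(* Main.v *)
(** Idempotents form a chain, so for [q = a^-1 b] the product [f] of [a a^-1]
    and [b b^-1] is one of them.  If [c] in [S] satisfies [c^-1 c = f], then
    [q = (c a)^-1 (c b)] and both [c a] and [c b] are R-related to [c].  Such a
    [c] exists because, writing [f = x^-1 y] with [x], [y] in [S], the idempotents
    [x x^-1] and [y y^-1] are comparable, and [f = x^-1 x] or [f = y^-1 y]
    according to which of them is smaller. *)
Require Import Defs.
From mathcomp Require Import all_boot.

Local Open Scope group_scope.

Section IdempotentChain.
Variable Q : inverseSemigroupType.
Implicit Types (a b c e f x y : Q) (S : Q -> Prop).
Local Notation "x ^-1" := (isg_inv x) : group_scope.

Definition idempotents_chain :=
  forall e f, idempotent_elt e -> idempotent_elt f ->
    idempotent_le e f \/ idempotent_le f e.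

Lemma omega_chain_idempotents_chain :
  idempotents_omega_chain Q -> idempotents_chain.
Proof.
move=> [u [idem_u le_u]] e f /idem_u[m ->] /idem_u[n ->].
by case/orP: (leq_total n m) => ?; [left|right]; apply/le_u.
Qed.

Lemma isg_mulKV x : x * x^-1 * x = x.
Proof. by have [] := isg_invP x. Qed.

Lemma isg_mulVK x : x^-1 * x * x^-1 = x^-1.
Proof. by have [] := isg_invP x. Qed.

Lemma isg_invK x : x^-1^-1 = x.
Proof. by apply/esym/isg_inv_uniq; split; [apply: isg_mulVK|apply: isg_mulKV]. Qed.

Lemma idempotent_mulxV x : idempotent_elt (x * x^-1).
Proof. by rewrite /idempotent_elt mulgA isg_mulKV. Qed.

Lemma idempotent_mulVx x : idempotent_elt (x^-1 * x).
Proof. by rewrite /idempotent_elt mulgA isg_mulVK. Qed.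

Lemma idempotent_inv e : idempotent_elt e -> e^-1 = e.
Proof. by move=> ee; apply/esym/isg_inv_uniq; rewrite /mutually_inverse !ee. Qed.

Hypothesis chainQ : idempotents_chain.

Lemma idempotentC e f : idempotent_elt e -> idempotent_elt f -> e * f = f * e.
Proof. by move=> ie jf; case: (chainQ _ _ ie jf) => -[-> ->]. Qed.

Lemma idempotentM e f :
  idempotent_elt e -> idempotent_elt f -> idempotent_elt (e * f).
Proof. by move=> ie jf; case: (chainQ _ _ ie jf) => -[le1 le2]; rewrite ?le1 ?le2. Qed.

(** The idempotents [y * y^-1] and [x^-1 * x] commute; swapping them makes [y^-1 * x^-1] an inverse
    of [x * y], and inverses are unique. *)
Lemma isg_invM x y : (x * y)^-1 = y^-1 * x^-1.
Proof.
have yxC := idempotentC _ _ (idempotent_mulxV y) (idempotent_mulVx x).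
apply/esym/isg_inv_uniq; split.
  transitivity (x * ((y * y^-1) * (x^-1 * x)) * y); first by rewrite !mulgA.
  by rewrite yxC !mulgA isg_mulKV -!mulgA [y * _]mulgA isg_mulKV.
transitivity (y^-1 * ((x^-1 * x) * (y * y^-1)) * x^-1); first by rewrite !mulgA.
by rewrite -yxC !mulgA isg_mulVK -!mulgA [x^-1 * _]mulgA isg_mulVK.
Qed.

Lemma greenR_mulxV x y : x * x^-1 = y * y^-1 -> greenR x y.
Proof.
move=> xy; split; right.
  by exists (y^-1 * x); rewrite mulgA -xy isg_mulKV.
by exists (x^-1 * y); rewrite mulgA xy isg_mulKV.
Qed.

Lemma left_I_order_meets_L {S} (hS : left_I_order S) f :
  idempotent_elt f -> exists2 c, S c & c^-1 * c = f.
Proof.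
move=> ff; have [_ /(_ f)[a [b [Sa Sb fE]]]] := hS.
(* An idempotent is its own inverse, so inverting [a^-1 * b] gives [f] again. *)
have fV : f = b^-1 * a.
  by rewrite -(idempotent_inv _ ff) fE isg_invM isg_invK.
case: (chainQ _ _ (idempotent_mulxV a) (idempotent_mulxV b)) => -[ab ba].
  (* Using one form of [f] for each factor of [f * f] gives [a^-1 * (b * b^-1) * a], where
     [a * a^-1] absorbs the larger [b * b^-1]. *)
  exists a => //; rewrite -[RHS]ff {1}fE fV.
  transitivity (a^-1 * (b * b^-1 * (a * a^-1)) * a).
    by rewrite ba !mulgA isg_mulVK.
  by rewrite -!mulgA [a * _]mulgA isg_mulKV.
exists b => //; rewrite -[RHS]ff {1}fV fE.
transitivity (b^-1 * (a * a^-1 * (b * b^-1)) * b).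
  by rewrite ba !mulgA isg_mulVK.
by rewrite -!mulgA [b * _]mulgA isg_mulKV.
Qed.

(** The left side is [c * (x * x^-1) * c^-1]; writing its first [c] as [c * c^-1 * c] lets
    [c^-1 * c] absorb [x * x^-1]. *)
Lemma mulxV_absorb c x :
  c^-1 * c * (x * x^-1) = c^-1 * c -> c * x * (c * x)^-1 = c * c^-1.
Proof.
move=> cx; rewrite isg_invM -[in LHS](isg_mulKV c).
transitivity (c * (c^-1 * c * (x * x^-1)) * c^-1); first by rewrite !mulgA isg_mulKV.
by rewrite cx !mulgA isg_mulKV.
Qed.

Lemma left_I_order_straight {S} : left_I_order S -> straight S.
Proof.
move=> hS q; have [subS /(_ q)[a [b [Sa Sb qE]]]] := hS.
have [ia ib] := (idempotent_mulxV a, idempotent_mulxV b).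
have [c Sc cE] := left_I_order_meets_L hS _ (idempotentM _ _ ia ib).
exists (c * a), (c * b); split; [exact: subS|exact: subS| |].
  (* Both sides become [c * c^-1], since [c^-1 * c] is the product of [a * a^-1] and [b * b^-1] and
     so absorbs each. *)
  apply: greenR_mulxV; rewrite !mulxV_absorb // cE -[LHS]mulgA ?ib //.
  by rewrite -(idempotentC _ _ ia ib) mulgA ia.
(* In the middle, [a * a^-1] is absorbed by [a^-1] and [b * b^-1] by [b]. *)
rewrite qE isg_invM; transitivity (a^-1 * (c^-1 * c) * b); last by rewrite !mulgA.
by rewrite cE !mulgA isg_mulVK -!mulgA [b * _]mulgA isg_mulKV.
Qed.

End IdempotentChain.

Theorem lemma2p2 (Q : inverseSemigroupType) (S : Q -> Prop)
  (hQ : bisimple_inverse_omega Q) (hS : left_I_order S) : straight S.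
Proof.
have [_ omegaQ] := hQ.
exact: (left_I_order_straight Q (omega_chain_idempotents_chain Q omegaQ) hS).
Qed.
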